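(* Let $H$ be a real Hilbert space, let $m\ge1$, let $\mathcal{A}_i:H\to2^H$ ($i=1,\dots,m$) be maximally monotone, let $\mathcal{B}:H\to H$ be monotone and $L$-Lipschitz ($L>0$), let $\mathcal{C}:H\to H$ be $\beta$-cocoercive ($\beta>0$), and assume that the set of $\mathbf{x}\in H$ with $0\in\sum_{i=1}^m\mathcal{A}_i\mathbf{x}+\mathcal{B}\mathbf{x}+\mathcal{C}\mathbf{x}$ is nonempty. Let $\omega_1,\dots,\omega_m\in(0,1]$ with $\sum_i\omega_i=1$. Let $$a=\frac{17\beta L+10+\sqrt{(17\beta L+10)^2+144\beta^2L^2}}{6\beta L},\qquad\gamma\in\left(0,\frac{\beta}{5+(10+\frac6a)\beta L}\right).$$ Let $(\mathbf{z}_{i,0})_{i},(\mathbf{y}_{i,0})_i,(\mathbf{y}_{i,-1})_i\in H^m$ and iterate, for $n\ge0$, $$\mathbf{x}_{n+1}=\sum_{j=1}^m\omega_j\mathbf{z}_{j,n},$$ and for $i=1,\dots,m$: $$\mathbf{y}_{i,n+1}=J_{\frac{\gamma}{\omega_i}\mathcal{A}_i}\big(2\mathbf{x}_{n+1}-\mathbf{z}_{i,n}-\gamma\mathcal{B}(2\mathbf{y}_{i,n}-\mathbf{y}_{i,n-1})-\gamma\mathcal{C}\mathbf{y}_{i,n}\big),\qquad \mathbf{z}_{i,n+1}=\mathbf{z}_{i,n}+\mathbf{y}_{i,n+1}-\mathbf{x}_{n+1}.$$ Then $\{\mathbf{x}_n\}$ converges weakly to a point $\mathbf{x}$ satisfying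 $0\in\sum_{i=1}^m\mathcal{A}_i\mathbf{x}+\mathcal{B}\mathbf{x}+\mathcal{C}\mathbf{x}$.
   Context: $J_{T}=(\mathrm{Id}+T)^{-1}$ is the resolvent of a maximally monotone operator $T$. $\beta$-cocoercive means $\langle x-y,\mathcal{C}x-\mathcal{C}y\rangle\ge\beta\|\mathcal{C}x-\mathcal{C}y\|^2$ for all $x,y$. *)

(* Defs.v *)
From HB Require Import structures.
From mathcomp Require Import all_boot all_order all_algebra.
From mathcomp Require Import all_classical all_reals all_analysis.
Set Implicit Arguments. Unset Strict Implicit. Unset Printing Implicit Defensive.
Import Order.TTheory GRing.Theory Num.Theory.
Import numFieldNormedType.Exports.
Local Open Scope classical_set_scope.
Local Open Scope ring_scope.

Section Hilbert.
Variables (R : realType) (H : lmodType R) (ip : H -> H -> R).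

Definition ipnorm (x : H) : R := Num.sqrt (ip x x).

Definition is_hilbert : Prop :=
  [/\ (forall x y, ip x y = ip y x),
      (forall a x y z, ip (a *: x + y) z = a * ip x z + ip y z),
      (forall x, 0 <= ip x x),
      (forall x, ip x x = 0 -> x = 0) &
      (forall u : nat -> H,
         (forall e : R, 0 < e -> exists N, forall m n, (N <= m)%N -> (N <= n)%N ->
             ipnorm (u m - u n) < e) ->
         exists l, forall e : R, 0 < e -> exists N, forall n, (N <= n)%N ->
             ipnorm (u n - l) < e)].

Definition weakly_converges (u : nat -> H) (l : H) : Prop :=
  forall y : H, (fun n => ip (u n) y) @ \oo --> ip l y.

Definition monotone_op (A : H -> set H) : Prop :=
  forall x y u v, A x u -> A y v -> 0 <= ip (x - y) (u - v).

Definition maximally_monotone (A : H -> set H) : Prop :=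
  monotone_op A /\
  forall x u, (forall y v, A y v -> 0 <= ip (x - y) (u - v)) -> A x u.

Definition monotone_fun (B : H -> H) : Prop :=
  forall x y, 0 <= ip (x - y) (B x - B y).

Definition lipschitz_fun (L : R) (B : H -> H) : Prop :=
  forall x y, ipnorm (B x - B y) <= L * ipnorm (x - y).

Definition cocoercive (beta : R) (C : H -> H) : Prop :=
  forall x y, beta * ip (C x - C y) (C x - C y) <= ip (x - y) (C x - C y).

(* resolvent J_{c A} = (Id + c A)^{-1}, as a set-valued map:
   p \in J_{cA}(u) iff u \in p + c A p *)
Definition resolvent (c : R) (A : H -> set H) (u : H) : set H :=
  [set p | exists a, A p a /\ u = p + c *: a].

Definition zero_in_sum (m : nat) (A : 'I_m -> H -> set H) (B C : H -> H)
    (x : H) : Prop :=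
  exists a : 'I_m -> H, (forall i, A i x (a i)) /\
    \sum_(i < m) a i + B x + C x = 0.

End Hilbert.

(* Main.v *)
(** In the product space H^m, weighted by omega, the projection P onto the diagonal
    turns the scheme into a Douglas-Rachford iteration for N_D + A + B + C with a
    reflected forward step for B and a forward step for C.  Two inequalities are
    added: the Fejer estimate towards a fixed point, and the monotonicity of A
    between consecutive iterates.  After splitting z_{n+1} - z_n into its components
    p in D and q orthogonal to D, the increments of y are
    p_{n+1} + (q_{n+1} - q_n), and the resulting Lyapunov function decreases as soon
    as 10 gamma L + 5 gamma / beta <= 1, which the bound on gamma implies.  Weak
    cluster points are limits along ultrafilters on nat, represented by Riesz'
    theorem.  They are fixed points because the limit of the pairings <y_n, a_n>
    along the graph of A and that of <y_n, (B + C) y_n> are opposite, which makes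
    both demiclosedness inequalities equalities.  Opial's argument then identifies
    all cluster points. *)

Require Import Defs.
From HB Require Import structures.
From mathcomp Require Import all_boot all_order all_algebra.
From mathcomp Require Import all_classical all_reals all_analysis.
From mathcomp Require Import ring lra.
Set Implicit Arguments.
Unset Strict Implicit.
Import Order.TTheory GRing.Theory Num.Theory.
Import numFieldNormedType.Exports.
Local Open Scope classical_set_scope.
Local Open Scope ring_scope.

(** * Inner product calculus and Riesz representation *)

Lemma ipnorm_lt (R : realType) (E : lmodType R) (ip : E -> E -> R) u (e : R) :
  0 < e -> (ipnorm ip u < e) = (ip u u < e ^+ 2).
Proof.
move=> e0; rewrite /ipnorm -{1}(gtr0_norm e0) -sqrtr_sqr ltr_sqrt //.
by rewrite exprn_gt0.
Qed.

Section InnerProduct.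
Variables (R : realType) (E : lmodType R) (ip : E -> E -> R).
Hypothesis hE : is_hilbert ip.

Lemma ipC u v : ip u v = ip v u.
Proof. by case: hE. Qed.

Lemma ip_ge0 u : 0 <= ip u u.
Proof. by case: hE. Qed.

Lemma ip_eq0 u : ip u u = 0 -> u = 0.
Proof. by case: hE => _ _ _ + _; exact. Qed.

Lemma ipDl u v w : ip (u + v) w = ip u w + ip v w.
Proof. by case: hE => _ h _ _ _; rewrite -[u]scale1r h scale1r mul1r. Qed.

Lemma ip0l w : ip 0 w = 0.
Proof. by apply: (addIr (ip 0 w)); rewrite -ipDl !add0r. Qed.

Lemma ipZl a u w : ip (a *: u) w = a * ip u w.
Proof. by case: hE => _ h _ _ _; rewrite -[a *: u]addr0 h ip0l addr0. Qed.

Lemma ipNl u w : ip (- u) w = - ip u w.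
Proof. by rewrite -scaleN1r ipZl mulN1r. Qed.

Lemma ip0r w : ip w 0 = 0.
Proof. by rewrite ipC ip0l. Qed.

Lemma ipDr u v w : ip u (v + w) = ip u v + ip u w.
Proof. by rewrite ipC ipDl !(ipC u). Qed.

Lemma ipZr a u w : ip u (a *: w) = a * ip u w.
Proof. by rewrite ipC ipZl (ipC u). Qed.

Lemma ipNr u w : ip u (- w) = - ip u w.
Proof. by rewrite ipC ipNl (ipC u). Qed.

Definition ipE := (ipDl, ipDr, ipNl, ipNr, ipZl, ipZr).

Lemma ip_cauchy u v : ip u v ^+ 2 <= ip u u * ip v v.
Proof.
have [->|v0] := eqVneq v 0; first by rewrite !ip0r expr2 !mulr0.
have v_gt0 : 0 < ip v v.
  by rewrite lt_neqAle ip_ge0 andbT eq_sym; apply: contra v0 => /eqP/ip_eq0 ->.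
have := ip_ge0 (ip v v *: u - ip u v *: v).
rewrite !ipE (ipC v u) => h.
rewrite -subr_ge0 -(pmulr_rge0 _ v_gt0).
by apply: le_trans h _; rewrite le_eqVlt; apply/orP; left; apply/eqP; ring.
Qed.

Lemma ip_young c u v : 0 < c -> 2 * ip u v <= c * ip u u + c^-1 * ip v v.
Proof.
move=> c0; have := ip_ge0 (c *: u - v); rewrite !ipE (ipC v u) => h.
rewrite -subr_ge0 -(pmulr_rge0 _ c0).
apply: le_trans h _; rewrite le_eqVlt; apply/orP; left; apply/eqP.
by field; rewrite gt_eqF.
Qed.

Lemma ip_norm_le u v M N : 0 <= M -> 0 <= N -> ip u u <= M -> ip v v <= N ->
  `|ip u v| <= Num.sqrt M * Num.sqrt N.
Proof.
move=> M0 N0 uM vN; rewrite -sqrtrM // -sqrtr_sqr; apply: ler_wsqrtr.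
by apply: le_trans (ip_cauchy u v) _; apply: ler_pM => //; exact: ip_ge0.
Qed.

Lemma ip_sqrD_le u v : ip (u + v) (u + v) <= 2 * (ip u u + ip v v).
Proof. by have := ip_ge0 (u - v); rewrite !ipE (ipC v u); lra. Qed.

Lemma ip_sqrB_le u v : ip (u - v) (u - v) <= 2 * (ip u u + ip v v).
Proof. by have := ip_sqrD_le u (- v); rewrite ipNl ipNr opprK. Qed.

Lemma cvg0_ip {T : Type} {F : set_system T} {FF : Filter F} (a b : T -> E) M :
  ip (a t) (a t) @[t --> F] --> 0 -> (forall t, ip (b t) (b t) <= M) ->
  ip (a t) (b t) @[t --> F] --> 0.
Proof.
move=> a0 bM; apply: norm_cvg0.
have cs : Num.sqrt (ip (a t) (a t)) * Num.sqrt M @[t --> F] --> (0 : R).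
  rewrite -[X in _ --> X](mul0r (Num.sqrt M)); apply: cvgMl; rewrite -sqrtr0.
  exact: (cvg_comp _ _ a0 (@sqrt_continuous _ 0)).
apply: (squeeze_cvgr _ (cvg_cst (0 : R)) cs).
apply: filterE => t; rewrite normr_ge0 /=.
by apply: ip_norm_le => //; [exact: ip_ge0 | exact: le_trans (ip_ge0 (b t)) _].
Qed.


(* The representer minimises the functional [v |-> |v|^2 - 2 f v]. *)
Lemma riesz (f : E -> R) M : (forall u v, f (u + v) = f u + f v) ->
  (forall a u, f (a *: u) = a * f u) -> (forall u, f u ^+ 2 <= M * ip u u) ->
  exists l, forall v, f v = ip l v.
Proof.
move=> fD fZ fM.
pose J v := ip v v - 2 * f v.
have J_ge v : - `|M| <= J v.
  rewrite /J; have v0 := ip_ge0 v; have := fM v; have := ler_norm M.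
  set N := `|M|; set a := ip v v in v0 * => MN fv.
  have N0 : 0 <= N by exact: normr_ge0.
  have : f v ^+ 2 <= N * a by nra.
  move=> fNa; rewrite leNgt; apply/negP => h.
  have h1 : 0 < 2 * f v - (a + N) by lra.
  have h2 : 0 < 2 * f v + (a + N) by lra.
  by have := mulr_gt0 h1 h2; have := sqr_ge0 (a - N); lra.
have hasI : has_inf (range J).
  by split; [exists (J 0), 0 | exists (- `|M|) => _ [v _ <-]].
set I := inf (range J).
have JI v : I <= J v by apply: ge_inf; [case: hasI | exists v].
have /choice [u uP] : forall n : nat, exists v, J v < I + n.+1%:R^-1.
  move=> n; have n0 : 0 < n.+1%:R^-1 :> R by rewrite invr_gt0.
  by have [_ [v _ <-]] := inf_adherent n0 hasI; exists v.
(* The parallelogram identity, with the value at the midpoint bounded below by [I], makes every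
   minimising sequence Cauchy. *)
have para v w : ip (v - w) (v - w) = 2 * (J v + J w) - 4 * J (2^-1 *: (v + w)).
  by rewrite /J fZ fD !ipE (ipC w v); field.
have cau v w : ip (v - w) (v - w) <= 2 * (J v - I) + 2 * (J w - I).
  by rewrite para; have := JI (2^-1 *: (v + w)); lra.
have inv0 : (n.+1%:R^-1 : R) @[n --> \oo] --> 0.
  exact: (@cvg_harmonic R).
have [l lP] : exists l, forall e : R, 0 < e -> exists N, forall n, (N <= n)%N ->
    ipnorm ip (u n - l) < e.
  case: hE => _ _ _ _; apply => e e0.
  have e4 : 0 < e ^+ 2 / 4 by rewrite divr_gt0 // exprn_gt0.
  have /cvgrPdist_lt/(_ _ e4)[N _ NP] := inv0; exists N => m n Nm Nn.
  rewrite ipnorm_lt //; apply: le_lt_trans (cau _ _) _.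
  have := NP _ Nm; have := NP _ Nn; rewrite /= !sub0r !normrN !ger0_norm ?invr_ge0 //.
  have := uP m; have := uP n; move: n.+1%:R^-1 m.+1%:R^-1 => r s; lra.
exists l => v.
have ul0 : ip (u n - l) (u n - l) @[n --> \oo] --> 0.
  apply/cvgrPdist_lt => e e0.
  have se : 0 < Num.sqrt e by rewrite sqrtr_gt0.
  have [N NP] := lP _ se; exists N => // n /= /NP.
  by rewrite ipnorm_lt // sqr_sqrtr ?(ltW e0) // sub0r normrN ger0_norm // ip_ge0.
have ulv : ip (u n) v @[n --> \oo] --> ip l v.
  have h := cvg0_ip ul0 (fun _ : nat => lexx (ip v v)).
  have -> : (fun n => ip (u n) v) = (fun n => ip (u n - l) v + ip l v).
    by apply/funext => n; rewrite -ipDl subrK.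
  rewrite -[X in _ --> X]add0r.
  by apply: cvgD; [exact: h | exact: cvg_cst].
set K := ip v v; have K0 : 0 <= K by exact: ip_ge0.
set c := ip l v - f v.
suff /eqP : c = 0 by rewrite subr_eq0 => /eqP.
(* Perturbing the minimiser along [v] gives t^2 K + 2 t c >= 0 in the limit. This [t] turns it into
   - t^2 (K + 2) >= 0; the [+ 1] keeps the denominator positive when [v = 0]. *)
pose t := - c / (K + 1).
have : 0 <= t ^+ 2 * K + 2 * t * c + 0.
  apply: (@cvgr_to_ge nat \oo _ R
    (fun n : nat => t ^+ 2 * K + 2 * t * (ip (u n) v - f v) + n.+1%:R^-1)).
    apply: cvgD; last exact: inv0.
    apply: cvgD; first exact: cvg_cst.
    by apply: cvgMr; apply: cvgB; [exact: ulv | exact: cvg_cst].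
  apply: filterE => n; have := JI (u n + t *: v); have := uP n.
  rewrite /J fD fZ !ipE (ipC v) -/K; move: n.+1%:R^-1 => r; lra.
have tK : t * (K + 1) = - c by rewrite /t divfK // gt_eqF //; lra.
have -> : c = - (t * (K + 1)) by rewrite tK opprK.
move=> h; suff -> : t = 0 by rewrite mul0r oppr0.
by apply/eqP; rewrite -sqrf_eq0; apply/eqP; nra.
Qed.

End InnerProduct.

(** * Limits along ultrafilters and weak compactness of bounded families *)

Lemma ultra_fmap (T S : Type) (f : T -> S) (U : set_system T) :
  UltraFilter U -> UltraFilter (fmap f U).
Proof.
move=> UU; split; first exact: fmap_proper_filter.
move=> G PG fUG; rewrite predeqE => A; split; last exact: fUG.
move=> GA; have [//|UnA] := in_ultra_setVsetC (f @^-1` A) UU.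
have GnA : G (~` A) by exact: fUG.
by have /filter_ex [? []] : G (A `&` ~` A) by exact: filterI.
Qed.

Lemma bounded_ultra_cvg (R : realType) (T : Type) (U : set_system T)
  (f : T -> R) (M : R) : UltraFilter U -> (forall t, `|f t| <= M) ->
  exists l : R, f @ U --> l.
Proof.
move=> UU fM.
have := @segment_compact R (- M) M.
rewrite compact_ultra => /(_ (f @ U)).
have UfU : UltraFilter (f @ U) by exact: ultra_fmap.
move=> /(_ UfU) [|l [_ lP]]; last by exists l.
by apply: (@filterE T U) => t /=; rewrite in_itv /= -ler_norml.
Qed.

(** If the preimage [S] of a neighbourhood were not in [F], the trace of [F] on the complement of
    [S] would be proper, and an ultrafilter extending it would contain both [S] and its
    complement. *)
Lemma ultra_cvg (R : realType) (T : Type) (F : set_system T) (f : T -> R)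
  (l : R) : Filter F ->
  (forall U : set_system T, UltraFilter U -> F `<=` U -> f @ U --> l) ->
  f @ F --> l.
Proof.
move=> FF h A lA; apply: contrapT => nFA.
set S := f @^-1` A in nFA.
have PF : ProperFilter (within (~` S) F).
  split; last exact: within_filter.
  move=> F0; apply: nFA; apply: (@filterS T F _ _ S _ F0) => t /= ht.
  by apply: contrapT.
have [U [UU FU]] := ultraFilterLemma PF.
have USn : U (~` S) by apply: FU; apply: (@filterE T F) => t.
have US : U S.
  by apply: (h U UU) lA => B FB; apply: FU; apply: (@filterS T F _ B) FB => t.
by have /filter_ex [t []] : U (S `&` ~` S) by exact: filterI.
Qed.

Section WeakCompactness.
Variables (R : realType) (E : lmodType R) (ip : E -> E -> R).
Hypothesis hE : is_hilbert ip.

(** For each [v] the scalar pairings stay in a compact interval, so they converge along [U]. The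
    limit is linear in [v] and bounded by Cauchy-Schwarz, hence represented by a vector. *)
Lemma ultra_weak_limit {T : Type} (U : set_system T) (u : T -> E) M :
  UltraFilter U -> (forall t, ip (u t) (u t) <= M) ->
  exists l, forall v, ip (u t) v @[t --> U] --> ip l v.
Proof.
move=> UU uM.
have bnd t v : `|ip (u t) v| <= Num.sqrt `|M| * Num.sqrt (ip v v).
  by apply: (ip_norm_le hE); rewrite ?normr_ge0 ?ip_ge0 //;
     exact: le_trans (uM t) (ler_norm M).
have /choice [f fP] : forall v, exists l : R, ip (u t) v @[t --> U] --> l.
  by move=> v; exact: (bounded_ultra_cvg UU (fun t => bnd t v)).
have uniq v (l : R) : ip (u t) v @[t --> U] --> l -> f v = l.
  by move=> h; exact: (cvg_unique (@norm_hausdorff _ R^o) (fP v) h).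
have [l lP] : exists l, forall v, f v = ip l v.
  apply: (riesz hE (M := `|M|)).
  - move=> v w; apply: uniq; under eq_fun do rewrite (ipDr hE).
    exact: cvgD.
  - move=> a v; apply: uniq; under eq_fun do rewrite (ipZr hE).
    by apply: cvgMr.
  - move=> v; have : `|f v| <= Num.sqrt `|M| * Num.sqrt (ip v v).
      apply: (@cvgr_to_le T U _ R (fun t => `|ip (u t) v|)).
        exact: cvg_norm (fP v).
      by apply: filterE => t.
    move=> h; rewrite -real_normK ?num_real // -[X in X * _]sqr_sqrtr //.
    rewrite -[ip v v in X in _ <= X]sqr_sqrtr ?(ip_ge0 hE) //.
    by rewrite -exprMn lerXn2r // nnegrE mulr_ge0 // sqrtr_ge0.
by exists l => v; rewrite -lP.
Qed.

End WeakCompactness.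

Lemma sub_cvg (T : Type) (V : topologicalType) (F G : set_system T) (f : T -> V)
  (l : V) : F `<=` G -> f @ F --> l -> f @ G --> l.
Proof. by move=> FG h X lX; apply: FG; exact: h. Qed.

(** * Quadratic estimates and demiclosedness *)

Section Estimates.
Variables (R : realType) (E : lmodType R) (ip : E -> E -> R).
Hypothesis hE : is_hilbert ip.

Lemma ip_inj u v : (forall w, ip u w = ip v w) -> u = v.
Proof.
move=> h; apply/eqP; rewrite -subr_eq0; apply/eqP/(ip_eq0 hE).
by rewrite (ipDl hE) (ipNl hE) h subrr.
Qed.

Lemma lipschitz_sqr L (B : E -> E) x y : 0 < L -> lipschitz_fun ip L B ->
  ip (B x - B y) (B x - B y) <= L ^+ 2 * ip (x - y) (x - y).
Proof.
move=> L0 /(_ x y); rewrite /ipnorm => h.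
rewrite -[leLHS]sqr_sqrtr ?(ip_ge0 hE) // -[ip (x - y) _]sqr_sqrtr ?(ip_ge0 hE) //.
by rewrite -exprMn lerXn2r // nnegrE ?mulr_ge0 ?sqrtr_ge0 // ltW.
Qed.

(** Split [w - y] as [(w - x) + (x - y)]: cocoercivity on the second part yields exactly the 2 beta
    |C x - C y|^2 that Young's inequality costs on the first. Here [x] is where the forward step
    evaluates [C], and [w] is the new iterate. *)
Lemma cocoercive_shift beta (C : E -> E) x y w : 0 < beta -> cocoercive ip beta C ->
  - (2 * ip (w - y) (C x - C y)) <= (2 * beta)^-1 * ip (w - x) (w - x).
Proof.
move=> b0 /(_ x y) h.
have b20 : 0 < (2 * beta)^-1 by rewrite invr_gt0 mulr_gt0.
have := ip_young hE (w - x) (- (C x - C y)) b20; rewrite invrK.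
have -> : w - y = (w - x) + (x - y) by rewrite addrA subrK.
move: (C x - C y) h => c h; move: (w - x) (x - y) h => u v h.
by rewrite (ipDl hE) !(ipNr hE) !(ipNl hE); lra.
Qed.

(** In this form two thirds of the reflected term split into the memory terms of the Lyapunov
    function and a remainder 2/3 |u|^2. *)
Lemma reflected_sqr u v :
  ip (2 *: u - v) (2 *: u - v) = 2 * ip (u - v) (u - v) + 2 * ip u u - ip v v.
Proof. by rewrite !(ipE hE) (ipC hE v u); ring. Qed.

(* The worst case is [q1 = - q0], [d1 = - d0], [d0 = - dm]: there
   [|2 d0 - dm| = 3 |d0|] and [|d1 - d0| = 2 |d0|], whence the weight 3/2 in Young's
   inequality, and [|q1|^2 = |q1 - q0|^2 / 4] is what has to absorb the excess. *)
Lemma lyapunov_decrease (gamma L h F0 F1 : R) (p0 p1 qm q0 q1 dm b : E) :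
  let g := gamma * L in let k := 17 / 6 * g + h in
  let d0 := p0 + (q0 - qm) in let d1 := p1 + (q1 - q0) in
  let sq u := ip u u in
  0 <= gamma -> 0 < L -> 0 <= h -> 10 * g + 10 * h <= 1 ->
  ip p0 q0 = 0 -> ip p1 q1 = 0 -> ip p1 q0 = 0 -> ip p0 q1 = 0 ->
  ip p0 qm = 0 -> ip p1 qm = 0 ->
  F1 <= F0 - (sq p1 + sq q1) + 2 * gamma * ip d0 b + h * sq d1 ->
  sq p1 + sq q1 + sq (q1 - q0) + sq (p1 - p0)
    <= sq p0 + sq q0 - 2 * gamma * ip d1 b + h * sq (d1 - d0) ->
  sq b <= L ^+ 2 * sq (2 *: d0 - dm) ->
  F1 + (sq p1 + sq q1)
    + g * (4 / 3 * sq (d1 - d0) + 2 / 3 * (sq d1 - sq d0))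
    + 2 * k * sq (q1 - q0) + 9 / 20 * sq q1 + 1 / 10 * (sq p1 + sq q1)
  <= F0 + (sq p0 + sq q0)
    + g * (4 / 3 * sq (d0 - dm) + 2 / 3 * (sq d0 - sq dm))
    + 2 * k * sq (q0 - qm) + 9 / 20 * sq q0.
Proof.
move=> g k d0 d1 sq ga0 L0 h0 gh pq00 pq11 pq10 pq01 pq0m pq1m FF mon bL.
have g0 : 0 <= g by rewrite mulr_ge0 // ltW.
have young : 2 * ip (d0 - d1) b <= L * (3 / 2 * sq (d1 - d0))
    + L * (2 / 3 * sq (2 *: d0 - dm)).
  have c0 : 0 < 3 / 2 * L by rewrite mulr_gt0.
  have := ip_young hE (d0 - d1) b c0.
  have : (3 / 2 * L)^-1 * sq b <= (3 / 2 * L)^-1 * (L ^+ 2 * sq (2 *: d0 - dm)).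
    by apply: ler_wpM2l => //; rewrite invr_ge0 ltW.
  have -> : (3 / 2 * L)^-1 * (L ^+ 2 * sq (2 *: d0 - dm))
     = L * (2 / 3 * sq (2 *: d0 - dm)) by field; rewrite gt_eqF.
  have -> : sq (d1 - d0) = ip (d0 - d1) (d0 - d1).
    by rewrite -opprB /sq (ipNl hE) (ipNr hE) opprK.
  by rewrite -/(sq b); lra.
have {young} := ler_wpM2l ga0 young.
have -> : gamma * (L * (3 / 2 * sq (d1 - d0)) + L * (2 / 3 * sq (2 *: d0 - dm)))
  = g * (3 / 2 * sq (d1 - d0)) + g * (2 / 3 * sq (2 *: d0 - dm)).
  by rewrite /g; ring.
rewrite {2}/sq reflected_sqr -!/(sq _) (ipDl hE) (ipNl hE) => young.
have sqd1 : sq d1 = sq p1 + sq (q1 - q0).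
  by rewrite /sq /d1 !(ipE hE) !(ipC hE q0) !(ipC hE q1) pq11 pq10; ring.
(* The weight of |d1 - d0|^2 is [k]: 3/2 [g] from Young's inequality, 4/3 [g] from the new memory
   term and [h] from cocoercivity. Orthogonality separates its [p] and [q] parts. *)
have D1 : sq (d1 - d0) <= sq (p1 - p0) + 2 * sq (q1 - q0) + 2 * sq (q0 - qm).
  have := ip_sqrB_le hE (q1 - q0) (q0 - qm).
  suff -> : sq (d1 - d0) = sq (p1 - p0) + ip ((q1 - q0) - (q0 - qm)) ((q1 - q0) - (q0 - qm)).
    by rewrite /sq; lra.
  rewrite /sq /d1 /d0 !(ipE hE) ?(ipC hE _ p1) ?(ipC hE _ p0).
  by rewrite ?pq11 ?pq10 ?pq01 ?pq00 ?pq0m ?pq1m; ring.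
have Dq := ip_sqrB_le hE q1 q0; rewrite -!/(sq _) in Dq.
have sq_ge0 u : 0 <= sq u by exact: (ip_ge0 hE).
have k0 : 0 <= k by rewrite /k; lra.
have kD1 := ler_wpM2l k0 D1.
have kp : k * sq (p1 - p0) <= 1 * sq (p1 - p0).
  by apply: ler_wpM2r => //; rewrite /k; lra.
(* All the weight on |q1 - q0|^2: 4 [k] plus the 2/3 [g] + [h] coming from |d1|^2. Only 1 is
   available from monotonicity; the excess 1/5 is paid through [Dq] by the |q1|^2 and |q0|^2
   terms. *)
have kq : (12 * g + 5 * h) * sq (q1 - q0) <= 6 / 5 * sq (q1 - q0).
  by apply: ler_wpM2r => //; lra.
have kp1 : (2 / 3 * g + h) * sq p1 <= 1 / 10 * sq p1.
  by apply: ler_wpM2r => //; lra.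
have := sq_ge0 p1; have := sq_ge0 q1; have := sq_ge0 q0.
have := sq_ge0 (q1 - q0).
rewrite sqd1 /k in FF kD1 kp young *.
move: (sq (q1 - q0)) (sq q0) (sq q1) (sq p1) (sq p0) (sq (p1 - p0)) (sq (d1 - d0))
  (sq (q0 - qm)) (sq (d0 - dm)) (sq d0) (sq dm) (ip d0 b) (ip d1 b)
  FF mon kD1 kp kq kp1 Dq young => *.
lra.
Qed.

(** Only the pairing with [b] and the difference |d|^2 - |dm|^2 can be negative. Both are absorbed
    by |d - dm|^2, by |p|^2 and |q - qm|^2 (whose sum is |d|^2), by |q|^2 and by half of |e|^2. *)
Lemma lyapunov_lower (gamma L h : R) (e pe p q qm dm b : E) :
  let g := gamma * L in let k := 17 / 6 * g + h in
  let d := p + (q - qm) in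
  let sq u := ip u u in
  0 <= gamma -> 0 < L -> 0 <= h -> 10 * g + 10 * h <= 1 ->
  ip p q = 0 -> ip p qm = 0 -> ip pe q = 0 -> sq pe <= sq e ->
  sq b <= L ^+ 2 * sq (pe + q - (d - dm)) ->
  1 / 2 * sq e <= sq e + 2 * gamma * ip d b + (sq p + sq q)
    + g * (4 / 3 * sq (d - dm) + 2 / 3 * (sq d - sq dm))
    + 2 * k * sq (q - qm) + 9 / 20 * sq q.
Proof.
move=> g k d sq ga0 L0 h0 gh pq pqm peq pee bL.
have g0 : 0 <= g by rewrite mulr_ge0 // ltW.
have sq_ge0 u : 0 <= sq u by exact: (ip_ge0 hE).
have young : - (2 * ip d b) <= L * (4 * sq d) + L * (1 / 4 * sq (pe + q - (d - dm))).
  have c0 : 0 < 4 * L by rewrite mulr_gt0.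
  have := ip_young hE d (- b) c0; rewrite !(ipNr hE) !(ipNl hE) opprK.
  have : (4 * L)^-1 * sq b <= (4 * L)^-1 * (L ^+ 2 * sq (pe + q - (d - dm))).
    by apply: ler_wpM2l => //; rewrite invr_ge0 ltW.
  have -> : (4 * L)^-1 * (L ^+ 2 * sq (pe + q - (d - dm)))
     = L * (1 / 4 * sq (pe + q - (d - dm))) by field; rewrite gt_eqF.
  by rewrite -/(sq b) -/(sq d); lra.
have split : sq (pe + q - (d - dm)) <= 3 * (sq pe + sq q) + 3 / 2 * sq (d - dm).
  have := sq_ge0 (2 *: (pe + q) + (d - dm)).
  have -> : sq pe + sq q = sq (pe + q).
    by rewrite /sq !(ipE hE) (ipC hE q pe) peq; ring.
  rewrite /sq; move: (pe + q) (d - dm) => u v.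
  by rewrite !(ipE hE) (ipC hE v u); lra.
have {young} young : - (2 * gamma * ip d b) <= g * (4 * sq d)
    + g * (1 / 4 * (3 * (sq e + sq q) + 3 / 2 * sq (d - dm))).
  have s2 : 1 / 4 * sq (pe + q - (d - dm))
      <= 1 / 4 * (3 * (sq e + sq q) + 3 / 2 * sq (d - dm)) by lra.
  by have := ler_wpM2l g0 s2; have := ler_wpM2l ga0 young; rewrite /g; lra.
(* Completing a square; the share 28/100 is small enough that 2/3 + 28/100 + 3/8 stays below the
   available 4/3 on |d - dm|^2, where 3/8 comes from [young]. *)
have mem : 2 / 3 * (sq d - sq dm)
    >= - (2 / 3) * sq (d - dm) - (28 / 100) * sq (d - dm) - 100 / 63 * sq d.
  have := sq_ge0 ((d - dm) + (50 / 21) *: d).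
  have -> : sq dm = sq (d - (d - dm)) by rewrite opprB addrC subrK.
  rewrite /sq; move: (d - dm) => v; move: (d : E) => u.
  by rewrite !(ipE hE) (ipC hE v u); lra.
have {mem} := ler_wpM2l g0 mem.
have sqd : sq d = sq p + sq (q - qm).
  by rewrite /sq /d !(ipE hE) (ipC hE q p) (ipC hE qm p) pq pqm; ring.
have ge : g * sq e <= 1 / 10 * sq e by apply: ler_wpM2r => //; lra.
have gq : g * sq q <= 1 / 10 * sq q by apply: ler_wpM2r => //; lra.
have gp : g * sq p <= 1 / 10 * sq p by apply: ler_wpM2r => //; lra.
have gD := mulr_ge0 g0 (sq_ge0 (d - dm)).
have gQ := mulr_ge0 g0 (sq_ge0 (q - qm)).
have hQ := mulr_ge0 h0 (sq_ge0 (q - qm)).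
rewrite sqd /k in young *.
have := sq_ge0 e; have := sq_ge0 q; have := sq_ge0 p.
move: (sq (q - qm)) (sq q) (sq p) (sq e) (sq (d - dm)) (sq dm) (ip d b)
  gD gQ hQ ge gq gp young => *.
lra.
Qed.

Lemma monotone_scaled (A : E -> set E) gamma x y u1 u0 b1 b0 c1 c0 :
  monotone_op ip A -> 0 < gamma ->
  A x (gamma^-1 *: u1 - b1 - c1) -> A y (gamma^-1 *: u0 - b0 - c0) ->
  gamma * (ip (x - y) (b1 - b0) + ip (x - y) (c1 - c0)) <= ip (x - y) (u1 - u0).
Proof.
move=> mA g0 /mA h /h {h}; rewrite -(pmulr_rge0 _ g0).
move: (x - y) => v; rewrite !(ipE hE) => h; rewrite -subr_ge0.
apply: le_trans h _; rewrite le_eqVlt; apply/orP; left; apply/eqP.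
by field; rewrite gt_eqF.
Qed.

Lemma cvg0_sqrD {T : Type} {F : set_system T} {FF : Filter F} (a b : T -> E) :
  ip (a t) (a t) @[t --> F] --> 0 -> ip (b t) (b t) @[t --> F] --> 0 ->
  ip (a t + b t) (a t + b t) @[t --> F] --> 0.
Proof.
move=> a0 b0.
have c0 : 2 * (ip (a t) (a t) + ip (b t) (b t)) @[t --> F] --> (0 : R).
  have -> : (0 : R) = 2 * (0 + 0) by ring.
  by apply: cvgMr; exact: cvgD.
apply: (squeeze_cvgr _ (cvg_cst (0 : R)) c0).
by apply: filterE => t; rewrite (ip_ge0 hE) (ip_sqrD_le hE).
Qed.

Lemma cvg0_sqr_le {T : Type} {F : set_system T} {FF : Filter F} (a b : T -> E)
  (K : R) : ip (a t) (a t) @[t --> F] --> 0 ->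
  (forall t, ip (b t) (b t) <= K * ip (a t) (a t)) ->
  ip (b t) (b t) @[t --> F] --> 0.
Proof.
move=> a0 ba.
have c0 : K * ip (a t) (a t) @[t --> F] --> (0 : R).
  by rewrite -[X in _ --> X](mulr0 K); exact: cvgMr.
apply: (squeeze_cvgr _ (cvg_cst (0 : R)) c0).
by apply: filterE => t; rewrite (ip_ge0 hE) ba.
Qed.

Lemma cvg0_sqrB {T : Type} {F : set_system T} {FF : Filter F} (a b : T -> E) :
  ip (a t) (a t) @[t --> F] --> 0 -> ip (b t) (b t) @[t --> F] --> 0 ->
  ip (a t - b t) (a t - b t) @[t --> F] --> 0.
Proof.
move=> a0 b0; apply: (cvg0_sqrD (b := fun t => - b t)) => //.
by apply: (cvg0_sqr_le (K := 1) b0) => t; rewrite (ipNl hE) (ipNr hE) opprK mul1r.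
Qed.

Lemma cocoercive_sqr beta (C : E -> E) x y : 0 < beta -> cocoercive ip beta C ->
  ip (C x - C y) (C x - C y) <= beta^-1 ^+ 2 * ip (x - y) (x - y).
Proof.
move=> b0 /(_ x y); move: (C x - C y) (x - y) => c u cu.
have bi0 : 0 < beta^-1 by rewrite invr_gt0.
have := ip_young hE u c bi0; rewrite invrK => yo.
have : beta * ip c c <= beta^-1 * ip u u by lra.
by rewrite -(ler_pM2l bi0) mulrA mulVf ?gt_eqF // mul1r mulrA expr2.
Qed.

Lemma lipschitz_bounded (S : E -> E) K (u : nat -> E) M : 0 <= K ->
  (forall x y, ip (S x - S y) (S x - S y) <= K * ip (x - y) (x - y)) ->
  (forall n, ip (u n) (u n) <= M) ->
  exists N, forall n, ip (S (u n)) (S (u n)) <= N.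
Proof.
move=> K0 lS uM; exists (2 * (K * M + ip (S 0) (S 0))) => n.
have := ip_sqrD_le hE (S (u n) - S 0) (S 0); rewrite subrK.
by have := lS (u n) 0; rewrite subr0; have := ler_wpM2l K0 (uM n); lra.
Qed.

(* [s] and [- s] are the limits of the pairings along the graphs of [S] and [A].
   Testing the second inequality at [x] and the first one at [(x, a)] forces
   [s = <x, b>], after which Minty's perturbation argument identifies [b]. *)
Lemma demiclosed_sum (A : E -> set E) (S : E -> E) K x a b s : 0 <= K ->
  maximally_monotone ip A ->
  (forall u v, ip (S u - S v) (S u - S v) <= K * ip (u - v) (u - v)) ->
  (forall y v, A y v -> 0 <= - s - ip x v - ip y a + ip y v) ->
  (forall y, 0 <= s - ip x (S y) - ip y b + ip y (S y)) ->
  ip x a = - ip x b -> A x a /\ S x = b.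
Proof.
move=> K0 [_ maxA] lS hA hS xab.
have s_ge := hS x.
have Axa : A x a.
  by apply: maxA => y v /hA; rewrite !(ipE hE) xab; lra.
split=> //.
have s_le := hA _ _ Axa.
have mint y : 0 <= ip (x - y) (b - S y).
  by have := hS y; rewrite !(ipE hE); lra.
suff w0 : b - S x = 0 by apply/esym/eqP; rewrite -subr_eq0 w0.
apply: (ip_eq0 hE); set w := b - S x.
have K1 : 0 < K + 1 by lra.
(* A finite step is enough for Minty's argument. Testing at [x + t *: w] and Young's inequality give
   |w|^2 <= |D|^2, while |D|^2 <= K t^2 |w|^2 with K t^2 = t - t^2 < 1. *)
pose t := (K + 1)^-1; have t0 : 0 < t by rewrite invr_gt0.
have tK : t * (K + 1) = 1 by rewrite mulVf // gt_eqF.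
have := mint (x + t *: w); have := lS (x + t *: w) x.
rewrite opprD addrA subrr add0r addrAC subrr add0r.
have -> : b - S (x + t *: w) = w - (S (x + t *: w) - S x).
  by rewrite /w opprB addrA subrK.
move: (S (x + t *: w) - S x) => D.
rewrite (ipZl hE) (ipZr hE) (ipNl hE) (ipZl hE) (ipDr hE) (ipNr hE) => lD mD.
have {}mD : ip w w - ip w D <= 0.
  by rewrite -oppr_ge0 -(pmulr_rge0 _ t0); rewrite mulrN -mulNr in mD *; lra.
have := ip_young hE w D ltr01; rewrite invr1 !mul1r => wD.
have w0 := ip_ge0 hE w.
apply/eqP; rewrite eq_le w0 andbT.
have Kt : K * (t * (t * ip w w)) = t * ip w w - t * (t * ip w w).
  by have -> : K = t^-1 - 1; [rewrite invrK addrK | field; rewrite gt_eqF].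
have t1 : t <= 1.
  by rewrite -tK ler_peMr ?(ltW t0) //; lra.
have tw : t * ip w w <= ip w w by rewrite -[leRHS]mul1r; exact: ler_wpM2r.
have ttw : 0 < t * t by exact: mulr_gt0.
by rewrite -(pmulr_rle0 _ ttw); lra.
Qed.

End Estimates.

(** * The iteration for an abstract orthogonal projection *)

Section Iteration.
Variables (R : realType) (E : lmodType R) (ip : E -> E -> R).
Hypothesis hE : is_hilbert ip.
Variable P : E -> E.
Hypothesis PB : forall u v, P (u - v) = P u - P v.
Hypothesis Psym : forall u v, ip (P u) v = ip u (P v).
Hypothesis PP : forall u, P (P u) = P u.
Variables (A : E -> set E) (B C : E -> E) (gamma L beta : R).
Hypothesis mA : maximally_monotone ip A.
Hypothesis mB : monotone_fun ip B.
Hypothesis L0 : 0 < L.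
Hypothesis lB : lipschitz_fun ip L B.
Hypothesis beta0 : 0 < beta.
Hypothesis cC : cocoercive ip beta C.
Hypothesis gamma0 : 0 < gamma.
Hypothesis gamma_lt : 10 * (gamma * L) + 5 * (gamma / beta) <= 1.
Variable z : nat -> E.

(* [Y k] is the iterate y_{k+1}, recovered from z_{k+1} = z_k + y_{k+1} - x_{k+1}
   with x_{k+1} = P z_k.  The resolvent steps are used from y_3 on, so that y_0
   and y_{-1}, which are not tied to [z], never occur. *)
Let dz k := z k.+1 - z k.
Let Y k := dz k + P (z k).
Let yh k := 2 *: Y k.+1 - Y k.
Let d k := Y k.+1 - Y k.
Let p k := P (dz k).
Let q k := dz k - P (dz k).
Let sq u := ip u u.
Let h := gamma * (2 * beta)^-1.
Let g := gamma * L.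

(** The resolvent inclusion for y_{k+3}: since z_{k+3} = z_{k+2} + y_{k+3} - P z_{k+2}, the residual
    2 P z_{k+2} - z_{k+2} - y_{k+3} equals P z_{k+2} - z_{k+3}. *)
Hypothesis step : forall k,
  A (Y k.+2) (gamma^-1 *: (P (z k.+2) - z k.+3) - B (yh k) - C (Y k.+1)).

(** This is [step] for the constant sequence [zs], along which all the [Y] equal [P zs]. *)
Definition fixed_point zs :=
  A (P zs) (gamma^-1 *: (P zs - zs) - B (P zs) - C (P zs)).

Let T zs k := ip (d k.+1) (B (yh k) - B (P zs)).

Lemma ipPq u v : ip (P u) (v - P v) = 0.
Proof. by rewrite Psym PB PP subrr (ip0r hE). Qed.

Lemma sq_proj u : ip u u = ip (P u) (P u) + ip (u - P u) (u - P u).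
Proof.
have := ipPq u u; rewrite !(ipE hE) (ipC hE u (P u)) => hP.
by rewrite -[ip (P u) u](subrK (ip (P u) (P u))) hP; ring.
Qed.

Lemma sq_dz k : sq (dz k) = sq (p k) + sq (q k).
Proof. exact: sq_proj. Qed.

Lemma diff_Y k : d k = p k.+1 + (q k.+1 - q k).
Proof.
apply: (ip_inj hE) => w.
by rewrite /d /Y /p /q /dz !PB !(ipE hE); ring.
Qed.

(** Monotonicity of [A] between y_{k+4} and [P zs]. With e = z_{k+3} - zs, the vectors P e and P e -
    e are orthogonal, which turns the main pairing into a difference of squares. *)
Lemma fejer_step zs k : fixed_point zs ->
  sq (z k.+4 - zs) + 2 * gamma * T zs k.+1
  <= sq (z k.+3 - zs) + 2 * gamma * T zs k - sq (dz k.+3)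
     + 2 * gamma * ip (d k.+1) (B (yh k.+1) - B (yh k)) + h * sq (d k.+2).
Proof.
move=> fz.
have := monotone_scaled hE (proj1 mA) gamma0 (step k.+1) fz.
have coco : gamma * - (2 * ip (Y k.+3 - P zs) (C (Y k.+2) - C (P zs)))
    <= h * sq (d k.+2).
  rewrite /h -mulrA; apply: ler_wpM2l; first exact: ltW.
  exact: (cocoercive_shift hE).
(* The reflection gives [Y k.+3 = yh k.+1 + d k.+2 - d k.+1]. Monotonicity of [B] handles
   [yh k.+1 - P zs]; the remaining increments telescope through [T]. *)
have mono : ip (Y k.+3 - P zs) (B (yh k.+1) - B (P zs)) >=
    T zs k.+1 - T zs k - ip (d k.+1) (B (yh k.+1) - B (yh k)).
  have := mB (yh k.+1) (P zs); rewrite /T /yh.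
  move: (B _) (B _) (B _) => b1 b0 bs; rewrite /d !(ipE hE); lra.
have {mono} := ler_wpM2l (ltW gamma0) mono.
have -> : ip (Y k.+3 - P zs) (P (z k.+3) - z k.+4 - (P zs - zs))
  = 1 / 2 * (sq (z k.+3 - zs) - sq (z k.+4 - zs) - sq (dz k.+3)).
  have -> : Y k.+3 - P zs = dz k.+3 + P (z k.+3 - zs) by rewrite /Y PB addrA.
  have -> : P (z k.+3) - z k.+4 - (P zs - zs)
      = P (z k.+3 - zs) - (z k.+3 - zs) - dz k.+3.
    by apply: (ip_inj hE) => w; rewrite /dz PB !(ipE hE); ring.
  have -> : z k.+4 - zs = z k.+3 - zs + dz k.+3.
    by apply: (ip_inj hE) => w; rewrite /dz !(ipE hE); ring.
  rewrite /sq; move: (dz _) (z k.+3 - zs) => w e.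
  have := ipPq e e; rewrite !(ipE hE) (ipC hE (P e) w) (ipC hE e w); lra.
move: (ip (Y _ - _) _) (ip (Y _ - _) _) (sq (_ - zs)) (sq (_ - zs)) coco
  => *; lra.
Qed.

(** Monotonicity of [A] between y_{k+4} and y_{k+3}; the orthogonality of [p] and [q] makes the main
    pairing a difference of squares. *)
Lemma consecutive_step k :
  sq (dz k.+3) + sq (q k.+3 - q k.+2) + sq (p k.+3 - p k.+2)
  <= sq (dz k.+2) - 2 * gamma * ip (d k.+2) (B (yh k.+1) - B (yh k))
     + h * sq (d k.+2 - d k.+1).
Proof.
have := monotone_scaled hE (proj1 mA) gamma0 (step k.+1) (step k).
have coco : gamma * - (2 * ip (d k.+2) (C (Y k.+2) - C (Y k.+1)))
    <= h * sq (d k.+2 - d k.+1).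
  rewrite /h -mulrA; apply: ler_wpM2l; first exact: ltW.
  have := cocoercive_shift hE (Y k.+2) (Y k.+1) (Y k.+1 + d k.+2) beta0 cC.
  rewrite addrAC subrr add0r; congr (_ <= _ * ip _ _).
    by apply: (ip_inj hE) => w; rewrite /d !(ipE hE); ring.
  by apply: (ip_inj hE) => w; rewrite /d !(ipE hE); ring.
rewrite -/(d k.+2).
have -> : ip (d k.+2) (P (z k.+3) - z k.+4 - (P (z k.+2) - z k.+3))
  = 1 / 2 * (sq (dz k.+2) - sq (dz k.+3) - sq (q k.+3 - q k.+2) - sq (p k.+3 - p k.+2)).
  have -> : P (z k.+3) - z k.+4 - (P (z k.+2) - z k.+3) = p k.+2 - p k.+3 - q k.+3.
    by apply: (ip_inj hE) => w; rewrite /p /q /dz !PB !(ipE hE); ring.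
  rewrite diff_Y !sq_dz /sq.
  have pq i j : ip (p i) (q j) = 0 by exact: ipPq.
  move: (p k.+2) (p k.+3) (q k.+2) (q k.+3) (pq k.+2 k.+2) (pq k.+2 k.+3)
    (pq k.+3 k.+2) (pq k.+3 k.+3) => p0 p1 q0 q1 e00 e01 e10 e11.
  rewrite !(ipE hE) (ipC hE q0 p0) (ipC hE q0 p1) (ipC hE q1 p0) (ipC hE q1 p1).
  by rewrite e00 e01 e10 e11 (ipC hE q1 q0) (ipC hE p1 p0); lra.
move: (ip (d _) _) (ip (d _) _) coco => *; lra.
Qed.

Let kk := 17 / 6 * g + h.
(** The [g] term carries the Young remainder of the reflected step to the next index, the [kk] term
    does so for the second difference of [q], and the last term is the reserve that pays for
    |q_{k+3} - q_{k+2}|^2. *)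
Let V zs k := sq (z k.+3 - zs) + 2 * gamma * T zs k + (sq (p k.+2) + sq (q k.+2))
  + g * (4 / 3 * sq (d k.+1 - d k) + 2 / 3 * (sq (d k.+1) - sq (d k)))
  + 2 * kk * sq (q k.+2 - q k.+1) + 9 / 20 * sq (q k.+2).

Lemma h_ge0 : 0 <= h.
Proof. by rewrite /h mulr_ge0 ?invr_ge0 ?mulr_ge0 // ltW. Qed.

Lemma gh_le1 : 10 * g + 10 * h <= 1.
Proof.
have -> : 10 * h = 5 * (gamma / beta) by rewrite /h; field; rewrite gt_eqF.
exact: gamma_lt.
Qed.

Lemma V_decrease zs k : fixed_point zs ->
  V zs k.+1 + 1 / 10 * sq (dz k.+3) <= V zs k.
Proof.
move=> fz; have pq i j : ip (p i) (q j) = 0 by exact: ipPq.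
have F := fejer_step k fz; have M := consecutive_step k.
have bL : sq (B (yh k.+1) - B (yh k)) <= L ^+ 2 * sq (2 *: d k.+1 - d k).
  have := lipschitz_sqr hE (yh k.+1) (yh k) L0 lB.
  congr (_ <= _ * ip _ _);
  by apply: (ip_inj hE) => w; rewrite /yh /d !(ipE hE); ring.
rewrite /V !sq_dz in F M *; rewrite !diff_Y in F M bL *.
have := lyapunov_decrease hE (ltW gamma0) L0 h_ge0 gh_le1 (pq _ _) (pq _ _)
  (pq _ _) (pq _ _) (pq _ _) (pq _ _) F M.
rewrite -!diff_Y in bL *.
move=> /(_ _ bL); rewrite -/g -/kk -!/(sq _) => H.
apply: le_trans H; rewrite le_eqVlt; apply/orP; left; apply/eqP; ring.
Qed.

Lemma V_lower zs k : fixed_point zs -> 1 / 2 * sq (z k.+3 - zs) <= V zs k.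
Proof.
move=> fz; have pq i j : ip (p i) (q j) = 0 by exact: ipPq.
pose e := z k.+3 - zs.
(* Here [Y k.+2] equals both [P (z k.+3) + q k.+2] and [yh k + (d k.+1 - d k)]. *)
have bL : sq (B (yh k) - B (P zs)) <= L ^+ 2 * sq (P e + q k.+2 - (d k.+1 - d k)).
  have := lipschitz_sqr hE (yh k) (P zs) L0 lB.
  congr (_ <= _ * ip _ _);
  by apply: (ip_inj hE) => w; rewrite /yh /d /Y /q /dz /e !PB !(ipE hE); ring.
have Pe : sq (P e) <= sq e.
  by have := sq_proj e; have := ip_ge0 hE (e - P e); rewrite /sq; lra.
rewrite /V /T; rewrite diff_Y in bL *.
exact: (lyapunov_lower hE (ltW gamma0) L0 h_ge0 gh_le1 (pq _ _) (pq _ _) (ipPq _ _) Pe bL).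
Qed.

Lemma sq_ge0 u : 0 <= sq u.
Proof. exact: (ip_ge0 hE). Qed.

Lemma sq_P_le u : sq (P u) <= sq u.
Proof. by have := sq_proj u; have := sq_ge0 (u - P u); rewrite /sq; lra. Qed.

Lemma sq_q_le k : sq (q k) <= sq (dz k).
Proof. by rewrite sq_dz; have := sq_ge0 (p k); lra. Qed.

Lemma V_nonincreasing zs : fixed_point zs -> nonincreasing_seq (V zs).
Proof.
move=> fz; apply/nonincreasing_seqP => k.
by have := V_decrease k fz; have := sq_ge0 (dz k.+3); lra.
Qed.

Lemma V_cvg zs : fixed_point zs -> exists v : R, V zs @ \oo --> v.
Proof.
move=> fz; exists (limn (V zs)); apply: nonincreasing_is_cvgn.
  exact: V_nonincreasing.
exists 0 => _ [k _ <-]; apply: le_trans (V_lower k fz).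
by rewrite mulr_ge0 // sq_ge0.
Qed.

Section WithFixedPoint.
Variable zs : E.
Hypothesis fz : fixed_point zs.

Lemma dz_cvg0 : sq (dz k) @[k --> \oo] --> 0.
Proof.
have [v Vv] := V_cvg fz.
have VvS : V zs k.+1 @[k --> \oo] --> v by rewrite (cvg_shiftS (V zs)).
rewrite -(cvg_shiftS (fun k => sq (dz k))) -(cvg_shiftS (fun k => sq (dz k.+1))).
rewrite -(cvg_shiftS (fun k => sq (dz k.+2))) /=.
have c0 : 10 * (V zs k - V zs k.+1) @[k --> \oo] --> (0 : R).
  rewrite -[X in _ --> X](mulr0 10) -(subrr v); apply: cvgMr.
  by apply: cvgB; [exact: Vv | exact: VvS].
apply: (squeeze_cvgr _ (cvg_cst (0 : R)) c0); apply: filterE => k.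
by rewrite sq_ge0 /=; have := V_decrease k fz; lra.
Qed.

Lemma q_cvg0 : sq (q k) @[k --> \oo] --> 0.
Proof.
apply: (cvg0_sqr_le hE (K := 1) dz_cvg0) => k.
by rewrite mul1r; exact: sq_q_le.
Qed.

Lemma d_cvg0 : sq (d k) @[k --> \oo] --> 0.
Proof.
have dE k : d k = dz k.+1 - q k.
  by apply: (ip_inj hE) => w; rewrite /d /Y /q /dz !PB !(ipE hE); ring.
under eq_fun do rewrite dE.
apply: (cvg0_sqrB hE); last exact: q_cvg0.
by rewrite (cvg_shiftS (fun k => sq (dz k))); exact: dz_cvg0.
Qed.

Lemma z_bounded : exists M, forall k, sq (z k) <= M.
Proof.
pose M3 := 2 * (2 * V zs 0 + sq zs).
have zM3 k : sq (z k.+3) <= M3.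
  have := ip_sqrD_le hE (z k.+3 - zs) zs; rewrite subrK -!/(sq _).
  have := V_lower k fz; have := V_nonincreasing fz (leq0n k).
  by rewrite /M3; lra.
have M30 := le_trans (sq_ge0 _) (zM3 0%N).
exists (M3 + sq (z 0%N) + sq (z 1%N) + sq (z 2%N)) => k.
have := sq_ge0 (z 0%N); have := sq_ge0 (z 1%N); have := sq_ge0 (z 2%N).
by case: k => [|[|[|k]]]; last have := zM3 k; lra.
Qed.

Lemma dz_bounded : exists M, forall k, sq (dz k) <= M.
Proof.
have [M zM] := z_bounded; exists (2 * (M + M)) => k.
by have := ip_sqrB_le hE (z k.+1) (z k); have := zM k; have := zM k.+1;
  rewrite /sq /dz; lra.
Qed.

Lemma Y_bounded : exists M, forall k, sq (Y k) <= M.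
Proof.
have [M zM] := z_bounded; have [N dN] := dz_bounded; exists (2 * (N + M)) => k.
have := ip_sqrD_le hE (dz k) (P (z k)); have := zM k; have := dN k.
by have := sq_P_le (z k); rewrite -/(Y k) /sq; lra.
Qed.

Lemma Byh_bounded : exists M, forall k, sq (B (yh k) - B (P zs)) <= M.
Proof.
have [M YM] := Y_bounded.
have yM k : sq (yh k) <= 10 * M.
  have := ip_sqrB_le hE (2 *: Y k.+1) (Y k); rewrite -/(yh k) (ipZl hE) (ipZr hE).
  by have := YM k; have := YM k.+1; rewrite /sq; lra.
have L20 : 0 <= L ^+ 2 by exact: sqr_ge0.
have [N BN] := lipschitz_bounded hE L20 (fun x y => lipschitz_sqr hE x y L0 lB) yM.
exists (2 * (N + sq (B (P zs)))) => k.
by have := ip_sqrB_le hE (B (yh k)) (B (P zs)); have := BN k; rewrite /sq; lra.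
Qed.

(** [V] converges and each of its other terms tends to 0. This is the ingredient of Opial's
    argument. *)
Lemma dist_cvg : exists v : R, sq (z k - zs) @[k --> \oo] --> v.
Proof.
have [v Vv] := V_cvg fz; exists v.
rewrite -(cvg_shiftS (fun k => sq (z k - zs))).
rewrite -(cvg_shiftS (fun k => sq (z k.+1 - zs))).
rewrite -(cvg_shiftS (fun k => sq (z k.+2 - zs))) /=.
have d1 : sq (d k.+1) @[k --> \oo] --> 0.
  by rewrite (cvg_shiftS (fun k => sq (d k))); exact: d_cvg0.
have dd := cvg0_sqrB hE d1 d_cvg0.
have dz2 : sq (dz k.+2) @[k --> \oo] --> 0.
  rewrite (cvg_shiftS (fun k => sq (dz k.+1))) (cvg_shiftS (fun k => sq (dz k))).
  exact: dz_cvg0.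
have q1 : sq (q k.+1) @[k --> \oo] --> 0.
  by rewrite (cvg_shiftS (fun k => sq (q k))); exact: q_cvg0.
have q2 : sq (q k.+2) @[k --> \oo] --> 0.
  by rewrite (cvg_shiftS (fun k => sq (q k.+1))).
have qq := cvg0_sqrB hE q2 q1.
have [M BM] := Byh_bounded.
have T0 : T zs k @[k --> \oo] --> 0 := cvg0_ip hE d1 BM.
have -> : (fun k => sq (z k.+3 - zs)) = (fun k => V zs k - (2 * gamma * T zs k
  + sq (dz k.+2) + g * (4 / 3 * sq (d k.+1 - d k) + 2 / 3 * (sq (d k.+1) - sq (d k)))
  + 2 * kk * sq (q k.+2 - q k.+1) + 9 / 20 * sq (q k.+2))).
  by apply/funext => k; rewrite /V sq_dz; ring.
have -> : v = v - (2 * gamma * 0 + 0 + g * (4 / 3 * 0 + 2 / 3 * (0 - 0))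
  + 2 * kk * 0 + 9 / 20 * 0) by ring.
apply: cvgB; first exact: Vv.
apply: cvgD; last by apply: cvgMr; exact: q2.
apply: cvgD; last by apply: cvgMr; exact: qq.
apply: cvgD; last first.
  apply: cvgMr; apply: cvgD; first by apply: cvgMr; exact: dd.
  by apply: cvgMr; apply: cvgB; [exact: d1 | exact: d_cvg0].
by apply: cvgD; [apply: cvgMr; exact: T0 | exact: dz2].
Qed.

Lemma sum_sqr x y : ip (B x + C x - (B y + C y)) (B x + C x - (B y + C y))
  <= 2 * (L ^+ 2 + beta^-1 ^+ 2) * ip (x - y) (x - y).
Proof.
rewrite opprD addrACA; have := ip_sqrD_le hE (B x - B y) (C x - C y).
have := lipschitz_sqr hE x y L0 lB; have := cocoercive_sqr hE x y beta0 cC.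
by lra.
Qed.

Lemma weak_cluster_fixed (U : set_system nat) zb : UltraFilter U -> \oo `<=` U ->
  (forall v, ip (z k.+2) v @[k --> U] --> ip zb v) -> fixed_point zb.
Proof.
move=> UU ooU zzb.
pose S u := B u + C u.
pose K := 2 * (L ^+ 2 + beta^-1 ^+ 2).
have K0 : 0 <= K by rewrite mulr_ge0 // addr_ge0 // sqr_ge0.
pose s k := S (Y k.+2).
(* The error made by evaluating [B] and [C] at [yh k] and [Y k.+1] instead of [Y k.+2]; it tends to
   0 in norm. *)
pose r k := (B (Y k.+2) - B (yh k)) + (C (Y k.+2) - C (Y k.+1)).
pose a k := gamma^-1 *: (P (z k.+2) - z k.+3) - B (yh k) - C (Y k.+1).
pose x := P zb.
have [M YM] := Y_bounded; have [Mz zM] := z_bounded.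
have YM2 k : ip (Y k.+2) (Y k.+2) <= M := YM k.+2.
have [N sN] : exists N, forall k, ip (s k) (s k) <= N.
  exact: (lipschitz_bounded hE K0 sum_sqr YM2).
have [b sb] := ultra_weak_limit hE UU sN.
(* Both factors converge only weakly, so compactness gives this limit without its value;
   [demiclosed_sum] takes it as the unknown [s]. *)
have [sigma sig] : exists l : R, ip (s k) (Y k.+2) @[k --> U] --> l.
  apply: (bounded_ultra_cvg UU) => k.
  exact: (ip_norm_le hE (le_trans (sq_ge0 _) (sN k)) (le_trans (sq_ge0 _) (YM2 k))).
have dz2 : ip (dz k.+2) (dz k.+2) @[k --> U] --> 0.
  apply: (sub_cvg ooU).
  rewrite (cvg_shiftS (fun k => sq (dz k.+1))) (cvg_shiftS (fun k => sq (dz k))).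
  exact: dz_cvg0.
have d1 : ip (d k.+1) (d k.+1) @[k --> U] --> 0.
  by apply: (sub_cvg ooU); rewrite (cvg_shiftS (fun k => sq (d k))); exact: d_cvg0.
have d0 : ip (d k) (d k) @[k --> U] --> 0 := sub_cvg ooU d_cvg0.
have r0 : ip (r k) (r k) @[k --> U] --> 0.
  apply: (cvg0_sqrD hE).
    apply: (cvg0_sqr_le hE (K := L ^+ 2) (cvg0_sqrB hE d1 d0)) => k.
    have -> : d k.+1 - d k = Y k.+2 - yh k.
      by apply: (ip_inj hE) => w; rewrite /d /yh !(ipE hE); ring.
    exact: (lipschitz_sqr hE).
  apply: (cvg0_sqr_le hE (K := beta^-1 ^+ 2) d1) => k.
  exact: (cocoercive_sqr hE).
have aE1 k v : ip (a k) v = gamma^-1 * (ip (P (z k.+2) - z k.+2) v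
    - ip (dz k.+2) v) - ip (s k) v + ip (r k) v.
  by rewrite /a /s /r /S /dz !(ipE hE); ring.
have aE k v : ip (a k) v = gamma^-1 * (ip (z k.+2) (P v) - ip (z k.+2) v
    - ip (dz k.+2) v) - ip (s k) v + ip (r k) v.
  by rewrite aE1 -Psym (ipDl hE) (ipNl hE).
have YE k v : ip (Y k.+2) v = ip (dz k.+2) v + ip (z k.+2) (P v).
  by rewrite /Y (ipDl hE) Psym.
have dzv v : ip (dz k.+2) v @[k --> U] --> 0.
  by apply: (cvg0_ip hE dz2 (M := ip v v)) => k.
have Yv v : ip (Y k.+2) v @[k --> U] --> ip x v.
  rewrite (funext (fun k => YE k v)).
  rewrite -[X in _ --> X]add0r /x Psym.
  by apply: cvgD; [exact: dzv | exact: zzb].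
pose ab := gamma^-1 *: (x - zb) - b.
have av v : ip (a k) v @[k --> U] --> ip ab v.
  rewrite (funext (fun k => aE k v)).
  have -> : ip ab v = gamma^-1 * (ip zb (P v) - ip zb v - 0) - ip b v + 0.
    by rewrite /ab /x -Psym !(ipE hE); ring.
  apply: cvgD; last first.
    by apply: (cvg0_ip hE r0 (M := ip v v)) => k.
  apply: cvgB; last exact: sb.
  apply: cvgMr; apply: cvgB; last exact: dzv.
  by apply: cvgB; exact: zzb.
(* [P z - z] is orthogonal to [P z], so its pairing with [Y] reduces to one with [dz], which
   vanishes strongly. *)
have aY : ip (a k) (Y k.+2) @[k --> U] --> - sigma.
  have -> : (fun k => ip (a k) (Y k.+2)) = (fun k => gamma^-1 *
      (ip (dz k.+2) (P (z k.+2) - z k.+2) - ip (dz k.+2) (Y k.+2))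
      - ip (s k) (Y k.+2) + ip (r k) (Y k.+2)).
    apply/funext => k; rewrite aE1; congr (_ * (_ - _) - _ + _).
    have := ipPq (z k.+2) (z k.+2); rewrite /Y.
    move: (dz k.+2) => w; move: (P (z k.+2)) => Pu; move: (z k.+2) => u.
    by rewrite !(ipE hE) (ipC hE w Pu) (ipC hE w u) (ipC hE Pu u); lra.
  have -> : - sigma = gamma^-1 * (0 - 0) - sigma + 0 by ring.
  apply: cvgD; last exact: (cvg0_ip hE r0 YM2).
  apply: cvgB; last exact: sig.
  apply: cvgMr; apply: cvgB; last exact: (cvg0_ip hE dz2 YM2).
  apply: (cvg0_ip hE dz2 (M := 2 * (Mz + Mz))) => k.
  have := ip_sqrB_le hE (P (z k.+2)) (z k.+2); have := zM k.+2.
  by have := sq_P_le (z k.+2); rewrite /sq; lra.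
have [] := demiclosed_sum hE (x := x) (a := ab) (b := b) (s := sigma) K0 mA sum_sqr.
- move=> y v Ayv.
  apply: (@cvgr_to_ge nat U _ R
    (fun k => ip (a k) (Y k.+2) - ip (Y k.+2) v - ip (a k) y + ip y v)).
    apply: cvgD; last exact: cvg_cst.
    apply: cvgB; last by rewrite (ipC hE y); exact: av.
    by apply: cvgB; [exact: aY | exact: Yv].
  apply: filterE => k; have := (proj1 mA) _ _ _ _ (step k) Ayv; rewrite -/(a k).
  move: (a k) (Y k.+2) => a1 u.
  by rewrite !(ipE hE) (ipC hE u a1) (ipC hE y a1); lra.
- move=> y.
  apply: (@cvgr_to_ge nat U _ R
    (fun k => ip (s k) (Y k.+2) - ip (Y k.+2) (S y) - ip (s k) y + ip y (S y))).
    apply: cvgD; last exact: cvg_cst.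
    apply: cvgB; last by rewrite (ipC hE y); exact: sb.
    by apply: cvgB; [exact: sig | exact: Yv].
  apply: filterE => k; have := mB (Y k.+2) y; have := cC (Y k.+2) y.
  have := mulr_ge0 (ltW beta0) (ip_ge0 hE (C (Y k.+2) - C y)).
  rewrite /s /S; move: (Y k.+2) => u.
  move: (B u) (B y) (C u) (C y) => b1 b2 c1 c2.
  rewrite [ip (c1 - c2) _]lock !(ipE hE) -lock.
  by rewrite (ipC hE b1 u) (ipC hE c1 u) (ipC hE b1 y) (ipC hE c1 y); lra.
(* [x - zb] is orthogonal to [x], so only [- b] contributes to the pairing of [x] with [ab]. *)
- have := ipPq zb zb; rewrite -/x /ab; move: (x : E) => u.
  rewrite !(ipE hE) => h0; have -> : ip u zb = ip u u by lra.
  by rewrite subrr mulr0; ring.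
move=> Axab Sb; rewrite /fixed_point.
by have <- : ab = gamma^-1 *: (P zb - zb) - B (P zb) - C (P zb)
  by rewrite /ab -Sb opprD addrA.
Qed.

End WithFixedPoint.

Theorem weak_cvg_fixed zs : fixed_point zs ->
  exists zb, fixed_point zb /\ weakly_converges ip z zb.
Proof.
move=> fz; have [Mz zM] := z_bounded fz.
have zM2 k : ip (z k.+2) (z k.+2) <= Mz := zM k.+2.
have lim_ex (U : set_system nat) : UltraFilter U -> \oo `<=` U -> exists zb,
    fixed_point zb /\ forall v, ip (z k.+2) v @[k --> U] --> ip zb v.
  move=> UU ooU; have [zb zzb] := ultra_weak_limit hE UU zM2.
  by exists zb; split => //; exact: (weak_cluster_fixed fz UU ooU zzb).
have [U0 [UU0 ooU0]] := ultraFilterLemma eventually_filter.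
have [zb [fzb zzb]] := lim_ex _ UU0 ooU0.
exists zb; split=> // v.
rewrite -(cvg_shiftS (fun k => ip (z k) v)) -(cvg_shiftS (fun k => ip (z k.+1) v)) /=.
apply: ultra_cvg => U UU ooU; have [zb' [fzb' zzb']] := lim_ex _ UU ooU.
suff -> : zb = zb' by exact: zzb'.
have [v1 c1] := dist_cvg fzb; have [v2 c2] := dist_cvg fzb'.
(* Up to a constant this pairing is half the difference of two convergent squared distances, so it
   converges along the whole sequence. Its limits along [U0] and [U] then agree, which says |zb' -
   zb|^2 = 0. *)
have cc : ip (z k.+2) (zb' - zb) @[k --> \oo]
    --> 1 / 2 * (v1 - v2 + (sq zb' - sq zb)).
  rewrite (cvg_shiftS (fun k => ip (z k.+1) (zb' - zb))).
  rewrite (cvg_shiftS (fun k => ip (z k) (zb' - zb))).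
  have -> : (fun k => ip (z k) (zb' - zb)) =
      (fun k => 1 / 2 * (sq (z k - zb) - sq (z k - zb') + (sq zb' - sq zb))).
    apply/funext => k; rewrite /sq; move: (z k) => u.
    by rewrite !(ipE hE) (ipC hE zb u) (ipC hE zb' u); field.
  apply: cvgMr; apply: cvgD; last exact: cvg_cst.
  by apply: cvgB; [exact: c1 | exact: c2].
have e1 := cvg_unique (@norm_hausdorff _ R^o) (sub_cvg ooU0 cc) (zzb (zb' - zb)).
have e2 := cvg_unique (@norm_hausdorff _ R^o) (sub_cvg ooU cc) (zzb' (zb' - zb)).
apply/esym/eqP; rewrite -subr_eq0; apply/eqP/(ip_eq0 hE).
by rewrite (ipDl hE) (ipNl hE) -e1 -e2 subrr.
Qed.

End Iteration.

(** * The weighted product space and its operators *)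

Section Product.
Variables (R : realType) (H : lmodType R) (ip : H -> H -> R).
Hypothesis hH : is_hilbert ip.
Variables (m : nat) (omega : 'I_m -> R).
Hypothesis omega0 : forall i, 0 < omega i.
Hypothesis omega1 : \sum_(i < m) omega i = 1.

Let E : lmodType R := {ffun 'I_m -> H}.

Definition wip (u v : E) : R := \sum_(i < m) omega i * ip (u i) (v i).
(** The adjoint of [diag] for [wip], which makes [dproj] the orthogonal projection onto the
    diagonal. *)
Definition wmean (u : E) : H := \sum_(i < m) omega i *: u i.
Definition diag (x : H) : E := [ffun=> x].
Definition dproj (u : E) : E := diag (wmean u).

Lemma ip_suml (F : 'I_m -> H) v : ip (\sum_i F i) v = \sum_i ip (F i) v.
Proof.
apply: (big_morph (fun u => ip u v)); last exact: (ip0l hH).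
by move=> u w; rewrite (ipDl hH).
Qed.

Lemma wip_ge_component (u : E) i : omega i * ip (u i) (u i) <= wip u u.
Proof.
rewrite /wip (bigD1 i) //= lerDl; apply: sumr_ge0 => j _.
by rewrite mulr_ge0 ?(ip_ge0 hH) // ltW.
Qed.

Lemma wip_hilbert : is_hilbert wip.
Proof.
have w0 (u : E) : 0 <= wip u u.
  by apply: sumr_ge0 => i _; rewrite mulr_ge0 ?(ip_ge0 hH) // ltW.
split=> //.
- by move=> u v; apply: eq_bigr => i _; rewrite (ipC hH).
- move=> a u v w; rewrite /wip mulr_sumr -big_split; apply: eq_bigr => i _ /=.
  by rewrite !ffunE (ipDl hH) (ipZl hH); ring.
- move=> u u0; apply/ffunP => i; rewrite ffunE; apply: (ip_eq0 hH).
  have := wip_ge_component u i; rewrite u0 => h; apply/eqP.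
  by rewrite eq_le (ip_ge0 hH) andbT -(pmulr_rle0 _ (omega0 i)).
- move=> u cu.
  have /choice [l lP] : forall i, exists l, forall e : R, 0 < e ->
      exists N, forall n, (N <= n)%N -> ipnorm ip (u n i - l) < e.
    move=> i; case: (hH) => _ _ _ _; apply => e e0.
    (* This tolerance in the product norm cancels the weight and leaves [e] for component [i]. *)
    have e20 : 0 < Num.sqrt (omega i * e ^+ 2).
      by rewrite sqrtr_gt0 mulr_gt0 // exprn_gt0.
    have [N NP] := cu _ e20; exists N => k n Nk Nn.
    have := NP _ _ Nk Nn; rewrite !ipnorm_lt // sqr_sqrtr; last first.
      by rewrite mulr_ge0 ?sqr_ge0 // ltW.
    move=> /(le_lt_trans (wip_ge_component _ i)).
    by rewrite ltr_pM2l // !ffunE.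
  exists [ffun i => l i] => e e0.
  have /choice [N NP] : forall i, exists N, forall n, (N <= n)%N ->
      ipnorm ip (u n i - l i) < e by move=> i; exact: lP.
  exists (\max_i N i)%N => n Nn; rewrite ipnorm_lt // /wip.
  have lt_i i : ip (u n i - l i) (u n i - l i) < e ^+ 2.
    rewrite -ipnorm_lt //; apply: NP; apply: leq_trans Nn.
    exact: (leq_bigmax (F := N)).
  rewrite -[ltRHS]mul1r -omega1 mulr_suml.
  have [i0 _] : exists i : 'I_m, true.
    apply: contrapT => nex; have : \sum_(i < m) omega i = 0.
      by apply: big1 => i; case: nex; exists i.
    by rewrite omega1 => /eqP; rewrite oner_eq0.
  apply: ltr_sum; last by move=> i _; rewrite !ffunE ltr_pM2l.
  by apply/hasP; exists i0; rewrite ?mem_index_enum.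
Qed.

Lemma wip_diagl x u : wip (diag x) u = ip x (wmean u).
Proof.
rewrite (ipC hH) ip_suml; apply: eq_bigr => i _.
by rewrite ffunE (ipZl hH) (ipC hH).
Qed.

Lemma wmeanB u v : wmean (u - v) = wmean u - wmean v.
Proof.
by rewrite /wmean -sumrB; apply: eq_bigr => i _; rewrite !ffunE scalerBr.
Qed.

Lemma wmean_diag x : wmean (diag x) = x.
Proof.
rewrite /wmean (eq_bigr (fun i => omega i *: x)) => [|i _]; last by rewrite ffunE.
by rewrite -scaler_suml omega1 scale1r.
Qed.

Lemma dprojB u v : dproj (u - v) = dproj u - dproj v.
Proof. by apply/ffunP => i; rewrite !ffunE wmeanB. Qed.

Lemma dproj_sym u v : wip (dproj u) v = wip u (dproj v).
Proof. by rewrite (ipC wip_hilbert u) !wip_diagl (ipC hH). Qed.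

Lemma dproj_proj u : dproj (dproj u) = dproj u.
Proof. by rewrite {1}/dproj wmean_diag. Qed.

Section Operators.
Variables (A : 'I_m -> H -> set H) (B C : H -> H).

(** The factor [omega i] compensates the weight in [wip], so that the resolvent with parameter gamma
    acts on component i with parameter gamma / omega_i. *)
Definition prod_op (u a : E) : Prop := forall i, A i (u i) (omega i *: a i).
Definition prod_fun (F : H -> H) (u : E) : E := [ffun i => F (u i)].

(** If component [j] were outside its graph, it would have a graph point with negative pairing.
    Every other component has one with nonpositive pairing, at worst itself, and assembling them
    contradicts the assumption on [(u, a)]. *)
Lemma prod_maximal : (forall i, maximally_monotone ip (A i)) ->
  maximally_monotone wip prod_op.
Proof.
move=> mA; split.
  move=> u v a b ua vb; apply: sumr_ge0 => i _.
  have := (mA i).1 _ _ _ _ (ua i) (vb i).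
  by rewrite !ffunE -scalerBr (ipZr hH).
move=> u a ha j; apply: contrapT => nA.
have /choice [w wP] : forall i, exists w : H * H, A i w.1 w.2 /\
    (ip (u i - w.1) (omega i *: a i - w.2) <= 0) /\
    (i = j -> ip (u i - w.1) (omega i *: a i - w.2) < 0).
  move=> i; have [Ai|nAi] := pselect (A i (u i) (omega i *: a i)).
    exists (u i, omega i *: a i); rewrite /= subrr (ip0l hH); split=> //.
    by split=> // ij; subst i.
  have : ~ forall y v, A i y v -> 0 <= ip (u i - y) (omega i *: a i - v).
    by move=> h; apply: nAi; exact: (mA i).2.
  move=> /existsNP [y /existsNP [v /not_implyP [Ayv /negP]]].
  by rewrite -ltNge => neg; exists (y, v); split=> //; split=> //; exact: ltW.
have /ha : prod_op [ffun i => (w i).1] [ffun i => (omega i)^-1 *: (w i).2].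
  move=> i; rewrite !ffunE scalerA mulfV ?gt_eqF // scale1r.
  exact: (wP i).1.
have eqi i : omega i * ip ((u - [ffun i => (w i).1]) i)
    ((a - [ffun i => (omega i)^-1 *: (w i).2]) i)
    = ip (u i - (w i).1) (omega i *: a i - (w i).2).
  by rewrite !ffunE !(ipE hH); field; rewrite gt_eqF.
rewrite /wip (eq_bigr _ (fun i _ => eqi i)) (bigD1 j) //= leNgt => /negP; apply.
have [_ [_ /(_ erefl) neg]] := wP j.
rewrite -[ltRHS]addr0; apply: ltr_leD => //.
by apply: sumr_le0 => i _; have [_ []] := wP i.
Qed.

Lemma prod_monotone : monotone_fun ip B -> monotone_fun wip (prod_fun B).
Proof.
move=> mB u v; apply: sumr_ge0 => i _; rewrite !ffunE mulr_ge0 //.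
exact: ltW.
Qed.

Lemma prod_lipschitz (L : R) : 0 < L -> lipschitz_fun ip L B ->
  lipschitz_fun wip L (prod_fun B).
Proof.
move=> L0 lB u v; rewrite /ipnorm -[L](gtr0_norm L0) -sqrtr_sqr.
rewrite -sqrtrM ?sqr_ge0 //; apply: ler_wsqrtr; rewrite /wip mulr_sumr.
apply: ler_sum => i _; rewrite !ffunE mulrCA; apply: ler_wpM2l; first exact: ltW.
exact: (lipschitz_sqr hH).
Qed.

Lemma prod_cocoercive (beta : R) : cocoercive ip beta C ->
  cocoercive wip beta (prod_fun C).
Proof.
move=> cC u v; rewrite /wip mulr_sumr; apply: ler_sum => i _.
by rewrite !ffunE mulrCA; apply: ler_wpM2l; [exact: ltW | exact: cC].
Qed.

End Operators.

End Product.

(** * Return from the product space to [H] *)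

Unset Implicit Arguments.

Theorem theorem4p2 (R : realType) (H : lmodType R) (ip : H -> H -> R)
  (m : nat) (A : 'I_m -> H -> set H) (B C : H -> H) (L beta : R)
  (omega : 'I_m -> R) (gamma : R)
  (x : nat -> H) (y z : 'I_m -> nat -> H) (ym1 : 'I_m -> H) :
  is_hilbert ip ->
  (0 < m)%N ->
  (forall i, maximally_monotone ip (A i)) ->
  monotone_fun ip B -> 0 < L -> lipschitz_fun ip L B ->
  0 < beta -> cocoercive ip beta C ->
  (exists x0, zero_in_sum A B C x0) ->
  (forall i, 0 < omega i <= 1) -> \sum_(i < m) omega i = 1 ->
  (let a := (17 * beta * L + 10
             + Num.sqrt ((17 * beta * L + 10) ^+ 2 + 144 * beta ^+ 2 * L ^+ 2))
            / (6 * beta * L) in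
   0 < gamma < beta / (5 + (10 + 6 / a) * beta * L)) ->
  (forall n, x n.+1 = \sum_(j < m) omega j *: z j n) ->
  (forall i n,
     let yprev := match n with O => ym1 i | S k => y i k end in
     resolvent (gamma / omega i) (A i)
       (2 *: x n.+1 - z i n - gamma *: B (2 *: y i n - yprev)
        - gamma *: C (y i n))
       (y i n.+1)) ->
  (forall i n, z i n.+1 = z i n + y i n.+1 - x n.+1) ->
  exists xb : H, zero_in_sum A B C xb /\ weakly_converges ip x xb.
Proof.
move=> hH _ mA mB L0 lB beta0 cC [x0 [a0 [Aa0 sum0]]] om omega1 /=.
set a := (X in 6 / X) => /andP[gamma0 gamma_lt] xE yE zE.
have omega0 i : 0 < omega i by have /andP[] := om i.
have bL0 := mulr_gt0 beta0 L0.
have a_gt0 : 0 < a.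
  rewrite divr_gt0 ?mulr_gt0 //; apply: ltr_pwDl; last exact: sqrtr_ge0.
  by move: bL0; lra.
(* Since 6 / a is positive, the bound on [gamma] gives gamma (5 + 10 beta L) < beta; then divide by
   beta. *)
have step_le : 10 * (gamma * L) + 5 * (gamma / beta) <= 1.
  have a6 : 0 < 6 / a by rewrite divr_gt0.
  have D0 : 0 < 5 + (10 + 6 / a) * beta * L.
    by rewrite ltr_pwDl // ltW // !mulr_gt0 // addr_gt0.
  rewrite ltr_pdivlMr // in gamma_lt.
  have := mulr_gt0 (mulr_gt0 gamma0 a6) bL0.
  rewrite -(ler_pM2r beta0) mul1r.
  have -> : (10 * (gamma * L) + 5 * (gamma / beta)) * beta
      = 10 * (gamma * L * beta) + 5 * gamma by field; rewrite gt_eqF.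
  by move: (6 / a) gamma_lt => c; lra.
pose zz k : {ffun 'I_m -> H} := [ffun i => z i k].
pose P := @dproj R H m omega.
have fB i (u v : {ffun 'I_m -> H}) : (u - v) i = u i - v i by rewrite !ffunE.
have fZ i r (u : {ffun 'I_m -> H}) : (r *: u) i = r *: u i by rewrite !ffunE.
have fF i F (u : {ffun 'I_m -> H}) : prod_fun F u i = F (u i) by rewrite ffunE.
have wzE k : wmean omega (zz k) = x k.+1.
  by rewrite xE; apply: eq_bigr => j _; rewrite ffunE.
have PzE k i : P (zz k) i = x k.+1 by rewrite ffunE wzE.
have YE k i : (zz k.+1 - zz k + P (zz k)) i = y i k.+1.
  rewrite ffunE PzE !ffunE zE; apply: (ip_inj hH) => w; rewrite !(ipE hH); ring.
(* Chosen so that its mean is [x0] and gamma^-1 (x0 - zs_i) - B x0 - C x0 is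
   [(omega i)^-1 *: a0 i]. *)
pose zs : {ffun 'I_m -> H} :=
  [ffun i => x0 - gamma *: ((omega i)^-1 *: a0 i + B x0 + C x0)].
have Pzs i : P zs i = x0.
  rewrite ffunE /wmean (eq_bigr (fun i =>
    omega i *: (x0 - gamma *: (B x0 + C x0)) - gamma *: a0 i)) => [|j _].
    rewrite sumrB -scaler_suml omega1 scale1r -scaler_sumr.
    have -> : \sum_i a0 i = - (B x0 + C x0) by apply/eqP; rewrite -addr_eq0 addrA sum0.
    by rewrite scalerN opprK subrK.
  rewrite ffunE; apply: (ip_inj hH) => w; rewrite !(ipE hH); field.
  by rewrite gt_eqF.
have := weak_cvg_fixed (wip_hilbert hH omega0 omega1)
  (@dprojB _ _ _ omega) (dproj_sym hH omega0 omega1) (dproj_proj omega1)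
  (prod_maximal hH omega0 mA) (prod_monotone omega0 mB) L0
  (prod_lipschitz hH omega0 L0 lB) beta0 (prod_cocoercive omega0 cC)
  gamma0 step_le (z := zz) _ (zs := zs).
case.
(* The scheme is read at n = k + 2, where both y_{k+2} and y_{k+1} can be recovered from [zz]. *)
- move=> k i; rewrite YE -/P.
  have [c [Ac eqc]] := yE i k.+2; suff -> : omega i *:
      (gamma^-1 *: (P (zz k.+2) - zz k.+3)
       - prod_fun B (2 *: (zz k.+2 - zz k.+1 + P (zz k.+1)) - (zz k.+1 - zz k + P (zz k)))
       - prod_fun C (zz k.+2 - zz k.+1 + P (zz k.+1))) i = c by [].
  rewrite 2!fB fZ !fF !fB fZ !YE PzE ffunE.
  have {eqc} := eqc; move: (B _) (C _) => b1 c1 eqc.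
  apply: (ip_inj hH) => w; have := congr1 (fun u => ip u w) eqc.
  have := congr1 (fun u => ip u w) (zE i k.+2); rewrite !(ipE hH) => -> e.
  have {}e : ip c w = omega i / gamma * (2 * ip (x k.+3) w - ip (z i k.+2) w
     - gamma * ip b1 w - gamma * ip c1 w - ip (y i k.+3) w).
    by rewrite e; field; rewrite !gt_eqF.
  by rewrite e; field; rewrite gt_eqF.
- move=> i; rewrite -/P; suff -> : omega i *: (gamma^-1 *: (P zs - zs)
      - prod_fun B (P zs) - prod_fun C (P zs)) i = a0 i by rewrite Pzs.
  rewrite 2!fB fZ !fF fB Pzs ffunE.
  apply: (ip_inj hH) => w; rewrite !(ipE hH); field.
  by rewrite !gt_eqF.
move=> zb [fzb zzb]; pose xb := wmean omega zb; exists xb; split.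
  (* The weighted mean of the [xb - zb i] is 0, so these elements sum to - B xb - C xb. *)
  exists (fun i => omega i *: (gamma^-1 *: (xb - zb i) - B xb - C xb)); split.
    by move=> i; have := fzb i; rewrite !ffunE.
  rewrite (eq_bigr (fun i => omega i *: (gamma^-1 *: xb - B xb - C xb)
      - gamma^-1 *: (omega i *: zb i))) => [|i _]; last first.
    by apply: (ip_inj hH) => w; rewrite !(ipE hH); ring.
  rewrite sumrB -scaler_suml omega1 scale1r -scaler_sumr -/(wmean omega zb) -/xb.
  by apply: (ip_inj hH) => w; rewrite !(ipE hH) (ip0l hH); ring.
(* Testing against a diagonal vector extracts the mean, and the mean of [zz k] is [x k.+1], hence
   the shift. *)
move=> v; rewrite -(cvg_shiftS (fun n => ip (x n) v)) /=.
have wE u : wip ip omega u (diag m v) = ip (wmean omega u) v.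
  by rewrite (ipC (wip_hilbert hH omega0 omega1)) (wip_diagl hH) (ipC hH).
have := zzb (diag m v); rewrite wE.
rewrite (funext (fun k => wE (zz k))).
have -> // : (fun k => ip (wmean omega (zz k)) v) = (fun k => ip (x k.+1) v).
by apply/funext => k; rewrite wzE.
Qed.
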